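(* Let $G$ be a finite simple graph of order $n$, let $\emptyset\neq W\subseteq V(G)$, let $G_W$ be the graph obtained from $G$ by attaching a self-loop at each vertex of $W$, and let $\overline{G_W}$ be the complement of the self-loop graph $G_W$ (with loops complemented as well). Then $$\mathcal{SE}(\overline{G_W})=\mathcal{SE}(G_W).$$
   Context: The Seidel matrix $S(G)=[s_{ij}]$ of a simple graph $G$ with vertices $v_1,\dots,v_n$ is the real symmetric $n\times n$ matrix with $s_{ii}=0$ for all $i$ and, for $i\ne j$, $s_{ij}=-1$ if $v_i,v_j$ are adjacent and $s_{ij}=1$ if they are non-adjacent. For $W\subseteq V(G)$ with $|W|=\sigma$, the Seidel matrix of the self-loop graph $G_W$ is $S(G_W)=S(G)-\mathfrak{I}_W$, where $\mathfrak{I}_W$ is the diagonal $n\times n$ matrix whose $(i,i)$ entry is $1$ if $v_i\in W$ and $0$ otherwise. The Seidel energy of $G_W$, a self-loop graph with $n$ vertices and $\sigma$ loops, is $\mathcal{SE}(G_W)=\sum_{i=1}^n\left|\theta_i(G_W)+\frac{\sigma}{n}\right|$, where $\theta_1(G_W),\dots,\theta_n(G_W)$ are the eigenvalues of $S(G_W)$ (with multiplicity). The same definitions apply to any self-loop graph (including one with $0$ loops), with $\sigma$ its number of loops. The complement $\overline{G_W}$ of $G_W$ is the self-loop graph on the same vertex set in which two distinct vertices are adjacent if and only if they are not adjacent in $G_W$, and in which a vertex has a loop if and only if it does not have a loop in $G_W$. *)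

(* Defs.v *)
From mathcomp Require Import all_boot all_order all_algebra.
From mathcomp Require Import reals.
From mathcomp Require Import polyrcf complex.

Set Implicit Arguments.
Unset Strict Implicit.
Unset Printing Implicit Defensive.

Import Order.TTheory GRing.Theory Num.Theory.
Local Open Scope ring_scope.

Record sgraph (V : finType) := SGraph {
  adj : rel V;
  adj_sym : symmetric adj;
  adj_irrefl : irreflexive adj
}.

Record loop_graph (V : finType) := LoopGraph {
  underlying : sgraph V;
  loops : {set V}
}.

Section Complement.
Variables (V : finType) (G : sgraph V).

Definition compl_adj : rel V := fun u v => (u != v) && ~~ adj G u v.

Lemma compl_adj_sym : symmetric compl_adj.
Proof. by move=> u v; rewrite /compl_adj eq_sym (adj_sym G). Qed.

Lemma compl_adj_irrefl : irreflexive compl_adj.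
Proof. by move=> u; rewrite /compl_adj eqxx. Qed.

Definition sgraph_compl : sgraph V := SGraph compl_adj_sym compl_adj_irrefl.
End Complement.

Definition loop_graph_compl (V : finType) (H : loop_graph V) : loop_graph V :=
  LoopGraph (sgraph_compl (underlying H)) (~: loops H).

(* Vertices are numbered by [enum_val : 'I_#|V| -> V]; the spectrum does not
   depend on the numbering. *)
Definition seidel_mx (R : pzRingType) (V : finType) (G : sgraph V) :
    'M[R]_#|V| :=
  \matrix_(i, j) if i == j then 0
                 else if adj G (enum_val i) (enum_val j) then - 1 else 1.

Definition loops_mx (R : pzRingType) (V : finType) (W : {set V}) :
    'M[R]_#|V| :=
  \matrix_(i, j) if (i == j) && (enum_val i \in W) then 1 else 0.

Definition seidel_loop_mx (R : pzRingType) (V : finType) (H : loop_graph V) :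
    'M[R]_#|V| :=
  seidel_mx R (underlying H) - loops_mx R (loops H).

(* The real eigenvalues, each listed as many times as its multiplicity as a
   root of the characteristic polynomial.  For a symmetric matrix this is the
   whole spectrum: see [char_poly_eigenvalues] and [size_eigenvalues]. *)
Definition eigenvalues (R : rcfType) (n : nat) (A : 'M[R]_n) : seq R :=
  flatten [seq nseq (mup x (char_poly A)) x | x <- rootsR (char_poly A)].

Definition seidel_energy (R : realType) (V : finType) (H : loop_graph V) : R :=
  \sum_(theta <- eigenvalues (seidel_loop_mx R H))
    `|theta + #|loops H|%:R / #|V|%:R|.

Lemma count_eigenvalues (R : rcfType) (n : nat) (A : 'M[R]_n) (x : R) :
  count_mem x (eigenvalues A) = mup x (char_poly A).
Proof.
have p0 : char_poly A != 0 by apply: monic_neq0; exact: char_poly_monic.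
rewrite /eigenvalues; set p := char_poly A in p0 *.
have E (s : seq R) : uniq s ->
    count_mem x (flatten [seq nseq (mup y p) y | y <- s])
    = if x \in s then mup x p else 0%N.
  elim: s => //= y s IH /andP[ys /IH Es].
  rewrite count_cat count_nseq Es in_cons /= eq_sym.
  have [->|] := eqVneq x y; first by rewrite (negbTE ys) mul1n addn0.
  by rewrite mul0n.
rewrite E ?uniq_roots //; have := roots_on_rootsR p0 x.
rewrite in_itv /= => <-; case: ifP => // /negbT /mupNroot -> //.
Qed.

Lemma char_poly_similar (F : fieldType) (n : nat) (P A B : 'M[F]_n) :
  P \in unitmx -> P *m A = B *m P -> char_poly A = char_poly B.
Proof.
move=> Pu PA; pose Q := map_mx polyC P.
have detQ : \det Q != 0.
  by rewrite det_map_mx polyC_eq0 -unitfE -unitmxE.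
apply: (mulfI detQ); rewrite [RHS]mulrC /char_poly -!det_mulmx.
congr (\det _); rewrite /char_poly_mx mulmxBr mulmxBl -!map_mxM PA.
by rewrite scalar_mxC.
Qed.

Lemma char_poly_split (R : rcfType) (n : nat) (A : 'M[R]_n) :
  A^T = A -> exists s : seq R, char_poly A = \prod_(x <- s) ('X - x%:P).
Proof.
move=> Asym; pose toC := real_complex R; pose B := map_mx toC A.
have Bherm : B \is hermsymmx.
  apply: realsym_hermsym.
    apply/is_hermitianmxP; rewrite expr0 scale1r map_mx_id //.
    by rewrite /B map_trmx Asym.
  by apply/mxOverP => i j; rewrite mxE; apply/complex_realP; exists (A i j).
have /mxOverP Dreal := hermitian_spectral_diag_real Bherm.
have /hermitian_normalmx/orthomx_spectralP := Bherm.
set P := spectralmx B; set d := spectral_diag B in Dreal * => BE.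
have Pu : P \in unitmx by exact: spectral_unit.
exists [seq complex.Re (d 0 i) | i <- enum 'I_n].
apply: (map_poly_inj toC); rewrite map_char_poly -/B.
rewrite (char_poly_similar Pu (_ : P *m B = diag_mx d *m P)); last first.
  by rewrite [in LHS]BE !mulmxA mulmxV // mul1mx.
rewrite char_poly_trig ?diag_mx_is_trig //.
rewrite rmorph_prod big_map big_enum /=; apply: eq_bigr => i _.
rewrite !mxE eqxx mulr1n map_polyXsubC; congr ('X - _%:P).
by apply/esym/RRe_real.
Qed.

Lemma char_poly_eigenvalues (R : rcfType) (n : nat) (A : 'M[R]_n) :
  A^T = A -> char_poly A = \prod_(x <- eigenvalues A) ('X - x%:P).
Proof.
move=> /char_poly_split[s Es]; rewrite [LHS]Es; apply: perm_big.
by apply/allP => x _ /=; rewrite count_eigenvalues Es mu_prod_XsubC.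
Qed.

Lemma size_eigenvalues (R : rcfType) (n : nat) (A : 'M[R]_n) :
  A^T = A -> size (eigenvalues A) = n.
Proof.
move=> /char_poly_eigenvalues/(congr1 (fun p : {poly R} => size p)).
by rewrite size_char_poly size_prod_XsubC => -[].
Qed.

(* Main.v *)
(* Since [S(complement of G) = - S(G)] and the loop matrices of [W] and of its
   complement sum to the identity, the matrix of the complement of [G_W] is
   [-1 - S(G_W)].  Its eigenvalues are the [-1 - theta], and
   [-1 - theta + (n - sigma) / n = - (theta + sigma / n)]. *)

Require Import Defs.
From mathcomp Require Import all_boot all_order all_algebra.
From mathcomp Require Import reals.

Set Implicit Arguments.
Unset Strict Implicit.
Unset Printing Implicit Defensive.

Import Order.TTheory GRing.Theory Num.Theory.
Local Open Scope ring_scope.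

(** Both lists contain each [x] exactly as often as its multiplicity as a root of [char_poly A]. *)
Lemma perm_eigenvalues (R : rcfType) (n : nat) (A : 'M[R]_n) (s : seq R) :
  char_poly A = \prod_(x <- s) ('X - x%:P) -> perm_eq (eigenvalues A) s.
Proof.
move=> As; apply/allP => x _ /=.
by rewrite count_eigenvalues As mu_prod_XsubC.
Qed.

(** Since ['X - (c - A) = - ((c - 'X) - A)], the sign leaves the determinant as [(-1) ^+ n], and
    substituting [c - 'X] for ['X] is a ring morphism, hence commutes with [\det]. *)
Lemma char_poly_scalar_sub (R : comNzRingType) (n : nat) (A : 'M[R]_n) (c : R) :
  char_poly (c%:M - A) = (-1) ^+ n * (char_poly A \Po (c%:P - 'X)).
Proof.
rewrite /char_poly -(det_map_mx (comp_poly (c%:P - 'X))) -detZ.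
congr (\det _); apply/matrixP => i j.
rewrite !mxE /= comp_polyB comp_polyC polyCB mulN1r !opprB.
case: eqP => _; rewrite ?mulr1n ?mulr0n ?comp_polyX ?comp_poly0.
  by rewrite opprB addrCA addrC.
by rewrite polyC0 add0r.
Qed.

Lemma perm_eigenvalues_scalar_sub (R : rcfType) (n : nat) (A : 'M[R]_n) (c : R) :
  A^T = A ->
  perm_eq (eigenvalues (c%:M - A)) [seq c - x | x <- eigenvalues A].
Proof.
move=> Asym; apply: perm_eigenvalues.
rewrite char_poly_scalar_sub (char_poly_eigenvalues Asym).
(* Only the exponent [n] becomes the number of eigenvalues; the induction then spends one factor
   [-1] per root, through [- ((c - 'X) - x) = 'X - (c - x)]. *)
rewrite -{1}(size_eigenvalues Asym) big_map rmorph_prod /=.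
elim: (eigenvalues A) => [|x s IHs]; first by rewrite !big_nil mulr1.
rewrite !big_cons -IHs exprS mulrACA; congr (_ * _).
rewrite comp_polyB comp_polyX comp_polyC polyCB mulN1r !opprB.
by rewrite addrC addrA addrAC.
Qed.

Lemma seidel_loop_mx_sym (R : pzRingType) (V : finType) (H : loop_graph V) :
  (seidel_loop_mx R H)^T = seidel_loop_mx R H.
Proof.
apply/matrixP => i j; rewrite !mxE (adj_sym (underlying H)) eq_sym.
by case: eqVneq => [->|].
Qed.

Lemma seidel_loop_mx_compl (R : pzRingType) (V : finType) (H : loop_graph V) :
  seidel_loop_mx R (loop_graph_compl H) = (-1)%:M - seidel_loop_mx R H.
Proof.
apply/matrixP => i j; rewrite !mxE /= /compl_adj (inj_eq enum_val_inj) inE.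
case: eqVneq => [->|_] /=.
  by case: (_ \in _); rewrite /= !sub0r ?oppr0 ?addr0 ?opprK ?addNr.
by case: adj; rewrite /= !subr0 sub0r ?opprK.
Qed.

Theorem theorem4p2 (R : realType) (V : finType) (G : sgraph V) (W : {set V})
    (W_neq0 : W != set0) :
  seidel_energy R (loop_graph_compl (LoopGraph G W))
  = seidel_energy R (LoopGraph G W).
Proof.
(* A vertex of [W] makes the order nonzero, as the simplification [n / n = 1] below requires. *)
have n_neq0 : #|V|%:R != 0 :> R.
  have [v _] := set0Pn _ W_neq0.
  by rewrite pnatr_eq0 -lt0n; apply/card_gt0P; exists v.
rewrite /seidel_energy seidel_loop_mx_compl.
rewrite (perm_big _ (perm_eigenvalues_scalar_sub _ (seidel_loop_mx_sym _ _))) /=.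
rewrite big_map; apply: eq_bigr => x _.
(* The loop ratio of the complement becomes [1 - #|W| / #|V|]; this [1] cancels the [-1] of the
   shifted eigenvalue. *)
rewrite cardsCs setCK natrB ?max_card // mulrBl divff //.
by rewrite -[RHS]normrN opprD addrACA addNr add0r.
Qed.
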